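(* Let $q$ be even, let $Q^+(5,q)$ be a hyperbolic (Klein) quadric in $\mathrm{PG}(5,q)$ with associated symplectic polarity $\zeta$, and let $\Pi$ be a $3$-dimensional subspace with $\Pi\cap Q^+(5,q)=Q^-(3,q)$ an elliptic quadric. Let $W(q)$ be the generalized quadrangle whose points are the points of $\Pi$ and whose lines are the lines of $\Pi$ meeting $Q^-(3,q)$ in exactly one point, and let $O$ be an ovoid of $W(q)$ distinct from $Q^-(3,q)$. For $x\in\Pi\setminus Q^-(3,q)$ let $\pi_x$ be the plane of $\Pi$ containing all lines of $W(q)$ through $x$ and $\mathcal{C}_x:=\pi_x^\zeta\cap Q^+(5,q)$. Put \[ H_O:=\Big(\bigcup_{x\in O\setminus Q^-(3,q)}\mathcal{C}_x\Big)\cup\big(Q^-(3,q)\setminus O\big). \] Then $H_O$ is a hyperoval of $Q^+(5,q)$ containing $\big((q^2+1)-|O\cap Q^-(3,q)|\big)(q+2)$ points, and the planes contained in $Q^+(5,q)$ that are disjoint from $H_O$ are precisely the planes of $Q^+(5,q)$ containing a point of $O\cap Q^-(3,q)$.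
   Context: $Q^+(5,q)$ is the set of singular points of a nondegenerate quadratic form $Q$ of plus type on $\mathbb{F}_q^6$, and $\zeta$ is the symplectic polarity associated with the bilinear form $B(v,w)=Q(v+w)-Q(v)-Q(w)$. An ovoid of $W(q)$ is a set of points of $\Pi$ meeting every line of $W(q)$ in exactly one point. A hyperoval of $Q^+(5,q)$ is a nonempty set of points of $Q^+(5,q)$ meeting every line contained in $Q^+(5,q)$ in $0$ or $2$ points. *)

(* Defs.v *)
From HB Require Import structures.
From mathcomp Require Import all_boot all_order all_algebra.

Set Implicit Arguments.
Unset Strict Implicit.
Unset Printing Implicit Defensive.

Import GRing.Theory.
Local Open Scope ring_scope.

(* Projective subspaces of PG(n-1,q) are linear subspaces of F^n; a projective
   subspace of dimension d is a {vspace 'rV[F]_n} of dimension d + 1, so that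
   points, lines, planes and solids have \dim 1, 2, 3 and 4.  The instances
   below make {set {vspace _}} available for sets of points. *)
Section FiniteSubspaces.
(* needed for the canonical injection of {vspace vT} into matrices *)
Import VectorInternalTheory.
Variables (K : finFieldType) (vT : vectType K).

HB.instance Definition _ := [Countable of {vspace vT} by <:].
HB.instance Definition _ := [Finite of {vspace vT} by <:].

End FiniteSubspaces.

Section QuadraticForms.

Variables (F : finFieldType) (n : nat).
Local Notation V := 'rV[F]_n.
Implicit Types (Q : V -> F) (U : {vspace V}).

Definition polar_form Q (v w : V) : F := Q (v + w) - Q v - Q w.

Definition quadratic_form Q : Prop :=
  (forall (a : F) (v : V), Q (a *: v) = a ^+ 2 * Q v)
  /\ bilinear_for *%R *%R (polar_form Q).

Definition nondegenerate_on Q U : Prop :=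
  forall v : V, v \in U -> Q v = 0 ->
    (forall w : V, w \in U -> polar_form Q v w = 0) -> v = 0.

Definition totally_singular Q U : bool := [forall v in U, Q v == 0].

Definition witt_index Q U : nat :=
  \max_(W : {vspace V} | (W <= U)%VS && totally_singular Q W) \dim W.

Definition plus_type_on Q U : Prop :=
  nondegenerate_on Q U /\ \dim U = (witt_index Q U).*2.

Definition minus_type_on Q U : Prop :=
  nondegenerate_on Q U /\ \dim U = (witt_index Q U).+1.*2.

(* linfun f agrees with f when f is linear, which is the case for polar_form Q v
   as soon as Q is a quadratic form. *)
Definition polarity Q U : {vspace V} :=
  (\bigcap_(v : V | v \in U) lker (linfun (polar_form Q v : V -> F^o)))%VS.

End QuadraticForms.

Section Geometry.

Variables (F : finFieldType) (n : nat).
Local Notation V := 'rV[F]_n.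
Local Notation subspace := {vspace V}.
Implicit Types (Q : V -> F) (Pi U L x : subspace) (E O H : {set subspace}).

Definition points_of U : {set subspace} :=
  [set x : subspace | (\dim x == 1)%N && (x <= U)%VS].

Definition quadric Q : {set subspace} :=
  [set x : subspace | (\dim x == 1)%N && totally_singular Q x].

Definition contained_in_quadric Q U : bool := points_of U \subset quadric Q.

Definition is_hyperoval Q H : Prop :=
  [/\ H != set0, H \subset quadric Q &
      forall L, \dim L = 2 -> contained_in_quadric Q L ->
        #|H :&: points_of L| = 0 \/ #|H :&: points_of L| = 2].

(* In the following, E is an elliptic quadric of the solid Pi. *)

Definition W_line Pi E L : bool :=
  [&& (\dim L == 2)%N, (L <= Pi)%VS & #|E :&: points_of L| == 1].

Definition is_W_ovoid Pi E O : Prop :=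
  O \subset points_of Pi /\
  forall L, W_line Pi E L -> #|O :&: points_of L| = 1.

(* The value 0 is a dummy: for a point x of W(q), there is exactly one such
   plane. *)
Definition W_plane Pi E x : subspace :=
  odflt 0%VS
    [pick P : subspace |
      [&& (\dim P == 3)%N, (P <= Pi)%VS &
          [forall (L : subspace | W_line Pi E L && (x <= L)%VS), (L <= P)%VS]]].

Definition conic_of Q Pi E x : {set subspace} :=
  points_of (polarity Q (W_plane Pi E x)) :&: quadric Q.

Definition hyperoval_of_ovoid Q Pi E O : {set subspace} :=
  (\bigcup_(x in O :\: E) conic_of Q Pi E x) :|: (E :\: O).

End Geometry.

(* Main.v *)
From HB Require Import structures.
Require Import Defs.
From mathcomp Require Import all_boot all_order all_algebra all_field.
From mathcomp Require Import zify ring.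

Set Implicit Arguments.
Unset Strict Implicit.
Unset Printing Implicit Defensive.

Import GRing.Theory.
Local Open Scope ring_scope.

(* Let M = Pi^zeta. Then F^6 is the orthogonal sum of Pi and M, and M is
   anisotropic because Q is of plus type. Let p be the projection onto Pi along
   M. For x outside the elliptic quadric E, the conic C_x consists of the
   singular points <v> with p(v) in x, so a singular point <v> lies in H_O iff
   exactly one of "v is in Pi" and "<p(v)> is in O" holds. The lines of W(q) are
   the totally isotropic lines of Pi. If L is a line of the quadric, p is
   injective on L, and there are two cases. If L meets Pi in a point e of E,
   then p(L) is a line of W(q) through e: its unique point in O is either e,
   and then L misses H_O, or another point, and then L has two points in H_O.
   Otherwise p(L) is not totally isotropic, L and p(L) have the same number of
   points in H_O and in O, and it remains to see that this number is 0 or 2.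

   For a point a of Pi, a^perp contains one point of O if a is in O and q + 1
   points otherwise. Summing over all points a of Pi yields |O| = q^2 + 1, and
   summing over a line l yields |l cap O| + |l^perp cap O| = 2. If l is not
   totally isotropic, one of the two terms vanishes, since a point of O on l and
   one on l^perp would span a line of W(q) with two points of O. *)

(** * Finite fields of even order *)

Section EvenFiniteField.

Variable F : finFieldType.
Hypothesis q_even : ~~ odd #|F|.

(** From a^q = a with q even, raising to the power q/2 inverts squaring. These explicit square roots
    allow a nonsingular vector to be rescaled to any value of the form. *)
Lemma expf_sqr_half (a : F) : (a ^+ 2) ^+ #|F|./2 = a.
Proof. by rewrite -exprM mul2n even_halfK // expf_card. Qed.

Lemma expf_half_sqr (a : F) : (a ^+ #|F|./2) ^+ 2 = a.
Proof. by rewrite -exprM muln2 even_halfK // expf_card. Qed.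

Lemma sqrf_inj : injective (fun a : F => a ^+ 2).
Proof. exact: (can_inj (g := fun a => a ^+ #|F|./2) expf_sqr_half). Qed.

Lemma oppr1_even : -1 = 1 :> F.
Proof. by apply: sqrf_inj; rewrite /= sqrrN. Qed.

Lemma oppr_even (V : lmodType F) (v : V) : - v = v.
Proof. by rewrite -scaleN1r oppr1_even scale1r. Qed.

End EvenFiniteField.

(** * Linear forms on subspaces, and lines spanned by two vectors *)

Section Subspaces.

Variables (K : fieldType) (vT : vectType K).
Implicit Types (U L : {vspace vT}) (u v w : vT).

(** A linear form has rank 0 or 1 on [U]; the boolean is that rank, so containment and hyperplane
    section share one equation. *)
Lemma dim_cap_lker (f : 'Hom(vT, K^o)) U :
  (\dim (U :&: lker f) + ~~ (U <= lker f)%VS)%N = \dim U.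
Proof.
rewrite -[RHS](limg_ker_dim f); congr addn.
have: (\dim (f @: U) <= 1)%N by rewrite -[leqRHS](dimvf (K^o)) dimvS ?subvf.
rewrite lkerE; case: eqP => [->|/eqP]; first by rewrite dimv0.
by rewrite -dimv_eq0; case: (\dim _) => [|[]].
Qed.

Lemma dim_add_vline u v :
  u != 0 -> v \notin <[u]>%VS -> \dim (<[u]> + <[v]>) = 2%N.
Proof.
move=> u0 uv; have v0: v != 0 by apply: contraNneq uv => ->; rewrite mem0v.
rewrite dimv_disjoint_sum ?dim_vline ?u0 ?v0 //.
apply/eqP; rewrite -subv0; apply/subvP => w /memv_capP[wu /vlineP[k wE]].
have [k0|k0] := eqVneq k 0; first by rewrite wE k0 scale0r mem0v.
by move: wu; rewrite wE rpredZeq (negPf k0) (negPf uv).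
Qed.

Lemma vline_eq u v : u != 0 -> u \in <[v]>%VS -> <[u]>%VS = <[v]>%VS.
Proof.
move=> u0 uv; apply/eqP; rewrite eqEdim -memvE uv !dim_vline u0.
by case: (v != 0).
Qed.

Lemma add_vline_eq L u v : \dim L = 2%N -> u \in L -> v \in L -> u != 0 ->
  v \notin <[u]>%VS -> (<[u]> + <[v]>)%VS = L.
Proof.
move=> dL uL vL u0 uv; apply/eqP; rewrite eqEdim dim_add_vline // dL leqnn.
by rewrite subv_add -!memvE uL vL.
Qed.

Lemma vline_repr U : \dim U = 1%N -> exists2 u, u != 0 & U = <[u]>%VS.
Proof.
move=> dU; have u0: vpick U != 0 by rewrite vpick0 -dimv_eq0 dU.
exists (vpick U) => //; apply/esym/eqP.
by rewrite eqEdim -memvE memv_pick dU dim_vline u0.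
Qed.

Lemma subv_ex U v : (1 < \dim U)%N -> exists2 u, u \in U & u \notin <[v]>%VS.
Proof.
move=> dU; apply/subvPn; apply: contraL dU => /dimvS; rewrite dim_vline -leqNgt.
by move/leq_trans; apply; case: (v != 0).
Qed.

Lemma subv_neq0_ex U : (0 < \dim U)%N -> exists2 u, u \in U & u != 0.
Proof.
by move=> dU; exists (vpick U); rewrite ?memv_pick // vpick0 -dimv_eq0 -lt0n.
Qed.

End Subspaces.

(** * Quadratic forms, polar forms and perpendicular spaces *)

Section QuadraticForm.

Variables (F : finFieldType) (n : nat) (Q : 'rV[F]_n -> F).
Hypothesis Qq : quadratic_form Q.
Local Notation V := 'rV[F]_n.
Local Notation B := (polar_form Q).
Implicit Types (u v w : V) (U W : {vspace V}).

Lemma quadZ a v : Q (a *: v) = a ^+ 2 * Q v. Proof. exact: Qq.1. Qed.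

Lemma quad0 : Q 0 = 0.
Proof. by rewrite -(scale0r 0) quadZ expr0n mul0r. Qed.

Lemma quadD u v : Q (u + v) = Q u + Q v + B u v.
Proof. by rewrite /polar_form [RHS]addrC addrA (addrAC _ (- Q v)) !subrK. Qed.

Lemma polar_linear v : linear (B v : V -> F^o). Proof. exact: Qq.2.2. Qed.

Lemma polarC u v : B u v = B v u.
Proof. by rewrite /polar_form addrAC (addrC u). Qed.

Lemma polarDr u v w : B u (v + w) = B u v + B u w.
Proof. by have := polar_linear u 1 v w; rewrite !scale1r. Qed.

Lemma polar0r u : B u 0 = 0.
Proof. by apply: (addrI (B u 0)); rewrite -polarDr !addr0. Qed.

Lemma polarZr a u v : B u (a *: v) = a * B u v.
Proof. by have := polar_linear u a v 0; rewrite !addr0 polar0r addr0. Qed.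

Lemma polarDl u v w : B (v + w) u = B v u + B w u.
Proof. by rewrite !(polarC _ u) polarDr. Qed.

Lemma polarZl a u v : B (a *: u) v = a * B u v.
Proof. by rewrite !(polarC _ v) polarZr. Qed.

Lemma polar0l u : B 0 u = 0. Proof. by rewrite polarC polar0r. Qed.

Lemma memv_lker_polar v w :
  (w \in lker (linfun (B v : V -> F^o))) = (B v w == 0).
Proof.
pose f : {linear V -> F^o} := HB.pack (B v : V -> F^o)
  (GRing.isLinear.Build _ _ _ _ _ (polar_linear v)).
by rewrite memv_ker (lfunE f).
Qed.

Lemma memv_polarity U w :
  reflect (forall u, u \in U -> B u w = 0) (w \in polarity Q U).
Proof.
rewrite memvE; apply: (iffP subv_bigcapP) => wU u /wU.
  by rewrite -memvE memv_lker_polar => /eqP.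
by rewrite -memvE memv_lker_polar => ->.
Qed.

Lemma memv_polarity_line v w : (w \in polarity Q <[v]>) = (B v w == 0).
Proof.
apply/memv_polarity/eqP => [-> //|vw u /vlineP[k ->]]; first exact: memv_line.
by rewrite polarZl vw mulr0.
Qed.

Lemma polarity_line v : polarity Q <[v]> = lker (linfun (B v : V -> F^o)).
Proof.
by apply/vspaceP => w; rewrite memv_polarity_line memv_lker_polar.
Qed.

Lemma dim_cap_polarity_line U v :
  (\dim (U :&: polarity Q <[v]>) + ~~ (U <= polarity Q <[v]>)%VS)%N = \dim U.
Proof. by rewrite polarity_line dim_cap_lker. Qed.

(** Each further vector of a spanning list lowers the dimension of the perpendicular space by at
    most one. *)
Lemma dim_polarity U : (n <= \dim (polarity Q U) + \dim U)%N.
Proof.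
suff dimP (s : seq V) : (n <= \dim (polarity Q <<s>>) + size s)%N.
  by have := dimP (vbasis U); rewrite size_tuple (span_basis (vbasisP U)).
elim: s => [|v s IHs] /=.
  rewrite span_nil addn0; apply: leq_trans (dimvS (_ : fullv <= _)%VS).
    by rewrite dimvf dim_matrix mul1r.
  by apply/subvP => w _; apply/memv_polarity => u; rewrite memv0 => /eqP ->;
    rewrite polar0l.
have := dim_cap_polarity_line (polarity Q <<s>>) v.
have: (\dim (polarity Q <<s>> :&: polarity Q <[v]>) <=
       \dim (polarity Q <<v :: s>>))%N.
  apply: dimvS; apply/subvP => w /memv_capP[/memv_polarity ws].
  rewrite memv_polarity_line => /eqP wv; apply/memv_polarity => u.
  rewrite span_cons => /memv_addP[_ /vlineP[k ->] [u2 us ->]].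
  by rewrite polarDl polarZl wv ws // mulr0 addr0.
by move: IHs; case: (_ <= _)%VS => /=; lia.
Qed.

Lemma totally_singularP W :
  reflect (forall w, w \in W -> Q w = 0) (totally_singular Q W).
Proof. by apply: (iffP forall_inP) => QW w /QW /eqP. Qed.

Lemma totally_singular_polar W u v :
  totally_singular Q W -> u \in W -> v \in W -> B u v = 0.
Proof.
move=> /totally_singularP QW uW vW.
by rewrite /polar_form !QW ?subr0 // rpredD.
Qed.

Lemma totally_singularD U W : totally_singular Q U -> totally_singular Q W ->
  (forall u w, u \in U -> w \in W -> B u w = 0) -> totally_singular Q (U + W).
Proof.
move=> /totally_singularP QU /totally_singularP QW BUW.
apply/totally_singularP => _ /memv_addP[u uU [w wW ->]].
by rewrite quadD QU // QW // BUW // !addr0.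
Qed.

Lemma totally_singular_vline v : totally_singular Q <[v]> = (Q v == 0).
Proof.
apply/totally_singularP/eqP => [-> //|Qv w /vlineP[k ->]].
  exact: memv_line.
by rewrite quadZ Qv mulr0.
Qed.

Lemma totally_singularS U W :
  (U <= W)%VS -> totally_singular Q W -> totally_singular Q U.
Proof.
by move=> /subvP UW /totally_singularP QW; apply/totally_singularP => u /UW/QW.
Qed.

Lemma witt_index_max U W : (W <= U)%VS -> totally_singular Q W ->
  (\dim W <= witt_index Q U)%N.
Proof.
by move=> WU QW; apply: (leq_bigmax_cond (F := fun W : {vspace V} => \dim W));
  rewrite WU.
Qed.

Lemma witt_index_ex U : exists W, [/\ (W <= U)%VS, totally_singular Q W &
  \dim W = witt_index Q U].
Proof.
pose A := [pred W : {vspace V} | (W <= U)%VS && totally_singular Q W].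
have A0: (0 < #|A|)%N.
  apply/card_gt0P; exists 0%VS; rewrite inE sub0v /=.
  by apply/totally_singularP => w; rewrite memv0 => /eqP ->; apply: quad0.
have [W] := eq_bigmax_cond (fun W : {vspace V} => \dim W) A0.
by rewrite inE => /andP[WU QW] EW; exists W; split => //; rewrite -EW.
Qed.

Section Even.

Hypothesis q_even : ~~ odd #|F|.

(** In characteristic 2 both v + v and Q v + Q v vanish, so [B] is alternating. *)
Lemma polarvv v : B v v = 0.
Proof.
have ->: B v v = Q (v - - v) - (Q v - - Q v).
  by rewrite /polar_form !opprK opprD addrA.
by rewrite (oppr_even q_even v) -(mulN1r (Q v)) oppr1_even // mul1r !subrr quad0 subrr.
Qed.

Lemma polar_add_vline (u v x y : V) : B u v = 0 ->
  x \in (<[u]> + <[v]>)%VS -> y \in (<[u]> + <[v]>)%VS -> B x y = 0.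
Proof.
move=> Buv /memv_addP[_ /vlineP[k ->] [_ /vlineP[l ->] ->]].
move=> /memv_addP[_ /vlineP[k' ->] [_ /vlineP[l' ->] ->]].
by rewrite !polarDl !polarDr !(polarZl, polarZr) (polarC v u)
   Buv !polarvv !mulr0 !addr0.
Qed.

End Even.

End QuadraticForm.

(** * Differences of powers of q, as products in r = q - 1 *)

Section PredPowers.

Local Open Scope nat_scope.
Variable r : nat.

Lemma expn2_sub1 : r.+1 ^ 2 - 1 = r * r.+2.
Proof. by rewrite (_ : r.+1 ^ 2 = r * r.+2 + 1) ?addnK //; ring. Qed.

Lemma expn4_sub1 : r.+1 ^ 4 - 1 = r * r.+2 * (r.+1 ^ 2 + 1).
Proof.
by rewrite (_ : r.+1 ^ 4 = r * r.+2 * (r.+1 ^ 2 + 1) + 1) ?addnK //; ring.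
Qed.

Lemma expn2_sub : r.+1 ^ 2 - r.+1 = r * r.+1.
Proof. by rewrite (_ : r.+1 ^ 2 = r * r.+1 + r.+1) ?addnK //; ring. Qed.

Lemma expn3_sub : r.+1 ^ 3 - r.+1 = r * r.+1 * r.+2.
Proof. by rewrite (_ : r.+1 ^ 3 = r * r.+1 * r.+2 + r.+1) ?addnK //; ring. Qed.

End PredPowers.

(** * Counting points through their vectors *)

Section PointCounting.

Variables (F : finFieldType) (n : nat).
Local Notation V := 'rV[F]_n.
Local Notation q := #|F|.
Implicit Types (U : {vspace V}) (A : {set {vspace V}}).

Lemma card_rV_vspace U : #|U| = (q ^ \dim U)%N.
Proof. exact: card_vspace. Qed.

Lemma card_vspaceD U W :
  (U <= W)%VS -> #|[pred v in W | v \notin U]| = (q ^ \dim W - q ^ \dim U)%N.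
Proof.
move=> /subvP UW; rewrite -!card_rV_vspace -(cardID (mem U) (mem W)).
rewrite (@eq_card _ [predI W & U] (mem U)); last first.
  by move=> v; rewrite !inE; apply/andb_idl/UW.
by rewrite addKn; apply: eq_card => v; rewrite !inE andbC.
Qed.

Lemma card_vspace_neq0 U : #|[pred v in U | v != 0]| = (q ^ \dim U - 1)%N.
Proof.
rewrite -card_rV_vspace [in RHS](cardD1 (0 : V)) mem0v add1n subn1 /=.
by apply: eq_card => a; rewrite !inE andbC.
Qed.

(** A point has q - 1 nonzero vectors, and the zero vector counts for nothing because its span has
    dimension 0. Later counts of points are made as sums over vectors, with the factor q - 1
    cancelled at the end. *)
Lemma sum_point_vectors A U : (forall x, x \in A -> \dim x = 1%N) ->
  (\sum_(v in U) (<[v]>%VS \in A) = (q - 1) * #|A :&: points_of U|)%N.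
Proof.
move=> dA; transitivity #|[pred v in U | <[v]>%VS \in A]|.
  by rewrite -sum1_card big_mkcondr; apply: eq_bigr => v _; case: (_ \in A).
transitivity (\sum_(x in A :&: points_of U)
  #|[pred v in x | v \notin (0%VS : {vspace V})]|)%N.
  rewrite -sum1_card.
  rewrite (partition_big (fun v : V => <[v]>%VS) (mem (A :&: points_of U))) /=.
    apply: eq_bigr => x; rewrite !inE => /and3P[xA /eqP dx /subvP xU].
    rewrite -sum1_card; apply: eq_bigl => v; rewrite !inE memv0.
    apply/andP/andP => [[/andP[vU vA] /eqP <-]|[vx v0]].
      split; first exact: memv_line.
      by have := dA _ vA; rewrite dim_vline; case: eqP.
    have -> : <[v]>%VS = x.
      by apply/eqP; rewrite eqEdim -memvE vx dx dim_vline v0.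
    by rewrite xU ?xA.
  by move=> v /andP[vU vA]; rewrite !inE vA dA // -memvE vU.
rewrite mulnC -sum_nat_const; apply: eq_bigr => x; rewrite !inE => /and3P[_ /eqP dx _].
by rewrite card_vspaceD ?sub0v // dx dimv0.
Qed.

End PointCounting.

(** * Intersections of an ovoid with lines and with planes a^perp *)

Section Ovoid.

Variables (F : finFieldType) (n : nat) (Q : 'rV[F]_n -> F).
Hypotheses (q_even : ~~ odd #|F|) (Qq : quadratic_form Q).
Local Notation V := 'rV[F]_n.
Local Notation B := (polar_form Q).
Local Notation q := #|F|.

Variables (Pi : {vspace V}) (O : {set {vspace V}}).
Hypothesis Pi_solid : \dim Pi = 4%N.
Hypothesis Pi_nondeg : (Pi :&: polarity Q Pi = 0)%VS.
Hypothesis O_points : O \subset points_of Pi.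
Hypothesis O_line : forall L, \dim L = 2%N -> (L <= Pi)%VS ->
  (forall u v, u \in L -> v \in L -> B u v = 0) -> #|O :&: points_of L| = 1%N.

Implicit Types (a u v w y z : V) (L : {vspace V}).
Local Notation o v := (<[v]>%VS \in O).

Lemma ovoid_dim x : x \in O -> \dim x = 1%N.
Proof. by move=> /(subsetP O_points); rewrite inE => /andP[/eqP]. Qed.

Lemma ovoid_mem v : o v -> v \in Pi.
Proof. by move=> /(subsetP O_points); rewrite inE -memvE => /andP[]. Qed.

Lemma ovoid_neq0 v : o v -> v != 0.
Proof. by move/ovoid_dim; rewrite dim_vline; case: eqP. Qed.

Lemma dim_perp a : a \in Pi -> a != 0 -> \dim (Pi :&: polarity Q <[a]>) = 3%N.
Proof.
move=> aPi a0; have := dim_cap_polarity_line Qq Pi a; rewrite Pi_solid.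
suff -> : (Pi <= polarity Q <[a]>)%VS = false by rewrite /= addn1 => -[].
apply: contraNF a0 => /subvP Pia; rewrite -memv0 -Pi_nondeg memv_cap aPi.
apply/(memv_polarity Qq) => u /Pia; rewrite memv_polarity_line //.
by rewrite (polarC Q) => /eqP.
Qed.

Lemma sum_isotropic u v : u \in Pi -> v \in Pi -> u != 0 ->
  v \notin <[u]>%VS -> B u v = 0 -> (\sum_(w in (<[u]> + <[v]>)%VS) o w = q - 1)%N.
Proof.
move=> uPi vPi u0 uv Buv; rewrite sum_point_vectors; last exact: ovoid_dim.
rewrite O_line ?muln1 // ?dim_add_vline //.
  by rewrite subv_add -!memvE uPi vPi.
by move=> x y; apply: polar_add_vline.
Qed.

Lemma sum_line a : a != 0 -> (\sum_(z in <[a]>%VS) o z = (q - 1) * o a)%N.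
Proof.
move=> a0; rewrite sum_point_vectors; last exact: ovoid_dim.
congr muln; case: (boolP (o a)) => oa /=.
  rewrite (_ : _ :&: _ = [set <[a]>%VS]) ?cards1 //; apply/setP => x; rewrite !inE.
  apply/idP/eqP => [/and3P[_ /eqP dx xa]|->].
    by apply/eqP; rewrite eqEdim xa dx dim_vline a0.
  by rewrite oa dim_vline a0 subvv.
apply/eqP; rewrite cards_eq0; apply/eqP/setP => x; rewrite !inE.
apply: contraNF oa => /and3P[xO /eqP dx xa]; rewrite (_ : <[a]>%VS = x) //.
by apply/eqP; rewrite eq_sym eqEdim xa dx dim_vline a0.
Qed.

(* Double counting of the pairs [(z, y)] with [y] on the line [<a, z>]. *)
Lemma sum_perp a : a \in Pi -> a != 0 ->
  (\sum_(z in (Pi :&: polarity Q <[a]>)%VS) o z + o a * (q * (q - 1)) = q ^ 2 - 1)%N.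
Proof.
move=> aPi a0; set P := (Pi :&: _)%VS; have dP : \dim P = 3%N by apply: dim_perp.
have aP : a \in P by rewrite memv_cap aPi memv_polarity_line // polarvv ?eqxx.
have aSP : (<[a]> <= P)%VS by rewrite -memvE.
pose S := (\sum_(z in P | z \notin <[a]>%VS) \sum_(y in (<[a]> + <[z]>)%VS) o y)%N.
have cardPa : #|[pred v in P | v \notin <[a]>%VS]| = (q ^ 3 - q)%N.
  by rewrite card_vspaceD // dP dim_vline a0.
have cardLa y : y \notin <[a]>%VS ->
    #|[pred v in (<[a]> + <[y]>)%VS | v \notin <[a]>%VS]| = (q ^ 2 - q)%N.
  by move=> ya; rewrite card_vspaceD ?addvSl // dim_add_vline // dim_vline a0.
(* Each z spans with a a totally isotropic line, whose single point of O has q - 1 nonzero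
   vectors. *)
have SE1 : S = ((q ^ 3 - q) * (q - 1))%N.
  rewrite /S (eq_bigr (fun=> (q - 1)%N)) => [|z].
    by rewrite sum_nat_const cardPa.
  rewrite memv_cap memv_polarity_line // => /andP[/andP[zPi /eqP Baz] za].
  exact: sum_isotropic.
have SE2 : S = (\sum_(y in P)
    \sum_(z in P | (z \notin <[a]>%VS) && (y \in (<[a]> + <[z]>)%VS)) o y)%N.
  rewrite (exchange_big_dep (fun z => (z \in P) && (z \notin <[a]>%VS))) /=; last first.
    by move=> y z _ /and3P[-> ->].
  apply: eq_bigr => z /andP[zP za]; apply: eq_bigl => y.
  rewrite zP za /= andb_idl //; apply/subvP.
  by rewrite subv_add aSP -memvE.
(* If y is on <a>, every z outside <a> has y on the line <a, z>; otherwise only the z of <a, y>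
   outside <a> do. *)
have {}SE2 : S = (\sum_(y in <[a]>%VS) o y * (q ^ 3 - q) +
   \sum_(y in P | y \notin <[a]>%VS) o y * (q ^ 2 - q))%N.
  rewrite SE2 (bigID (fun y => y \in <[a]>%VS)) /=; congr addn.
    apply: eq_big => [y|y ya]; first by apply/andb_idl/(subvP aSP).
    rewrite sum_nat_const mulnC -cardPa; congr muln.
    apply: eq_card => z; rewrite [LHS]unfold_in !inE; case: (z \in P) => //=.
    by rewrite andb_idr // => _; case/andP: ya => _; apply/subvP/addvSl.
  apply: eq_bigr => y /andP[yP ya].
  rewrite sum_nat_const mulnC -(cardLa y) //; congr muln.
  apply: eq_card => z; rewrite [LHS]unfold_in !inE.
  apply/and3P/andP => [[zP za yaz]|[zay za]].
    split=> //; rewrite (add_vline_eq (dim_add_vline a0 za) _ yaz a0 ya) //.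
      by rewrite memvE addvSr.
    by rewrite memvE addvSl.
  split=> //.
    by rewrite (subvP _ _ zay) // subv_add aSP -memvE.
  rewrite (add_vline_eq (dim_add_vline a0 ya) _ zay a0 za) //.
    by rewrite memvE addvSr.
  by rewrite memvE addvSl.
have nE : (\sum_(z in P) o z =
    (q - 1) * o a + \sum_(z in P | z \notin <[a]>%VS) o z)%N.
  rewrite (bigID (fun y => y \in <[a]>%VS)) /= -sum_line //; congr addn.
  by apply: eq_bigl => y; apply/andb_idl/(subvP aSP).
move: SE2; rewrite SE1 -!big_distrl /= sum_line // nE.
have : (1 < q)%N by apply: finRing_gt1.
case: q => [//|r] r_gt0.
set m := (\sum_(_ in _ | _) _)%N; rewrite expn3_sub expn2_sub expn2_sub1 subn1 /=.
move=> E; apply/eqP; rewrite -(@eqn_pmul2r (r * r.+1)) ?muln_gt0 ?andbT //.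
by move: E; lia.
Qed.

(** This is [sum_perp] summed over the vectors a of [U]: each z is counted once for every a in [U]
    perpendicular to it. The vector a = 0 is treated apart; its perpendicular space is all of [Pi],
    which gives the first term on the right. *)
Lemma sum_perps U : (U <= Pi)%VS ->
  (\sum_(z in Pi) o z * q ^ \dim (U :&: polarity Q <[z]>)
     + q * (q - 1) * (\sum_(v in U) o v)
   = \sum_(v in Pi) o v + (q ^ \dim U - 1) * (q ^ 2 - 1))%N.
Proof.
move=> /subvP UPi.
transitivity (\sum_(a in U) (\sum_(z in (Pi :&: polarity Q <[a]>)%VS) o z +
    o a * (q * (q - 1))))%N.
  rewrite big_split /= -big_distrl /= [X in (_ + X)%N]mulnC; congr addn.
  rewrite (exchange_big_dep (mem Pi)) => [|a z _ /=]; last first.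
    by rewrite memv_cap => /andP[].
  apply: eq_bigr => z zPi; rewrite sum_nat_const mulnC -card_rV_vspace; congr muln.
  apply: eq_card => a; rewrite [RHS]unfold_in /= !memv_cap.
  by rewrite !memv_polarity_line // zPi (polarC Q).
rewrite (bigD1 0) ?mem0v //= [<[0]>%VS \in O](contraTF (@ovoid_neq0 0)) ?eqxx //.
rewrite mul0n addn0; congr addn.
  apply: eq_bigl => z; rewrite memv_cap memv_polarity_line // (polar0l Qq) eqxx.
  by rewrite andbT.
rewrite (eq_bigr (fun=> (q ^ 2 - 1)%N)) => [|a /andP[/UPi aPi a0]]; last first.
  exact: sum_perp.
by rewrite sum_nat_const -card_vspace_neq0.
Qed.

Lemma sum_ovoid : (\sum_(v in Pi) o v = (q - 1) * (q ^ 2 + 1))%N.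
Proof.
have := sum_perps (subvv Pi); rewrite Pi_solid.
rewrite (eq_bigr (fun z => o z * q ^ 3)%N) => [|z zPi]; last first.
  case: (boolP (o z)) => [/ovoid_neq0 z0|_]; last by rewrite !mul0n.
  by rewrite dim_perp.
rewrite -big_distrl /=; set N := (\sum_(_ in _) _)%N.
have : (1 < q)%N by apply: finRing_gt1.
case: q => [//|r] r_gt0; rewrite expn4_sub1 expn2_sub1 subn1 /= => E.
(* The factor is (q - 1)(q + 1)^2 = q^3 + q^2 - q - 1, the coefficient of [N] once its occurrences
   are collected. *)
apply/eqP; rewrite -(@eqn_pmul2r (r * r.+2 * r.+2)) ?muln_gt0 ?andbT //.
by move: E; rewrite !expnS !expn0; lia.
Qed.

Lemma card_ovoid : #|O| = (q ^ 2 + 1)%N.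
Proof.
have q1 : (0 < q - 1)%N by rewrite subn_gt0 finRing_gt1.
apply/eqP; rewrite -(eqn_pmul2l q1) -sum_ovoid sum_point_vectors; last exact: ovoid_dim.
by rewrite (setIidPl O_points).
Qed.

Lemma sum_line_polarity L : \dim L = 2%N -> (L <= Pi)%VS ->
  (\sum_(v in L) o v + \sum_(v in (Pi :&: polarity Q L)%VS) o v
   = 2 * (q - 1))%N.
Proof.
move=> dL LPi; have := sum_perps LPi; rewrite dL sum_ovoid.
(* If z is in L^perp, then z^perp contains [L] and the weight is q^2 = q + q(q - 1); otherwise
   z^perp meets [L] in a point and the weight is q. *)
rewrite (eq_bigr (fun z =>
    o z * q + o z * ((z \in polarity Q L) * (q * (q - 1))))%N); last first.
  move=> z zPi; rewrite -mulnDr; congr muln.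
  have := dim_cap_polarity_line Qq L z; rewrite dL.
  rewrite (_ : (L <= _)%VS = (z \in polarity Q L)).
    case: (z \in _) => /=; [rewrite addn0 => ->|rewrite addn1 => -[->]].
      rewrite mul1n -mulnS subn1 prednK ?mulnn //.
      exact: ltnW (finRing_gt1 F).
    by rewrite mul0n addn0 expn1.
  apply/subvP/(memv_polarity Qq) => H u /H; rewrite memv_polarity_line // (polarC Q).
    by move/eqP.
  by move=> ->.
rewrite big_split -!big_distrl /= sum_ovoid.
under eq_bigr do rewrite mulnA.
rewrite -big_distrl /= (_ : \sum_(v in Pi) o v * (v \in polarity Q L) =
   \sum_(v in (Pi :&: polarity Q L)%VS) o v)%N; last first.
  rewrite [LHS](bigID (mem (polarity Q L))) /= [X in (_ + X)%N]big1 => [|v]; last first.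
    by move=> /andP[_ /negPf ->]; rewrite muln0.
  rewrite addn0; apply: eq_big => [v|v /andP[_ ->]]; last by rewrite muln1.
  by rewrite memv_cap.
have := finRing_gt1 F; case: q => [//|r]; rewrite expn2_sub1 subn1 /= => r_gt0 E.
apply/eqP; rewrite -(@eqn_pmul2r (r * r.+1)) ?muln_gt0 ?andbT //.
move: E; rewrite !expnS !expn0.
set K := (\sum_(_ in L) _)%N; set K' := (\sum_(_ in _) _)%N.
lia.
Qed.

Lemma ovoid_unique x z : o x -> o z -> B x z = 0 -> <[x]>%VS = <[z]>%VS.
Proof.
move=> ox oz Bxz; have [zx|zx] := boolP (z \in <[x]>%VS).
  by rewrite (vline_eq (ovoid_neq0 oz) zx).
set L := (<[x]> + <[z]>)%VS.
have dL : \dim L = 2%N by rewrite dim_add_vline // ovoid_neq0.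
have LPi : (L <= Pi)%VS by rewrite subv_add -!memvE !ovoid_mem.
have /eqP/cards1P[y Ey] := O_line dL LPi (fun u v => polar_add_vline Qq q_even Bxz).
have vline_y u : o u -> u \in L -> <[u]>%VS = y.
  move=> ou uL; apply/set1P; rewrite -Ey !inE ou -memvE uL.
  by rewrite dim_vline ovoid_neq0.
have -> : <[x]>%VS = y by apply: vline_y => //; rewrite memvE addvSl.
by apply/esym/vline_y => //; rewrite memvE addvSr.
Qed.

Lemma sum_hyperbolic L : \dim L = 2%N -> (L <= Pi)%VS ->
  (exists u v, [/\ u \in L, v \in L & B u v != 0]) ->
  (\sum_(v in L) o v = 0 \/ \sum_(v in L) o v = 2 * (q - 1))%N.
Proof.
move=> dL LPi [u [v [uL vL Buv]]].
have := sum_line_polarity dL LPi; set K' := (\sum_(_ in (Pi :&: _)%VS) _)%N.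
have [/eqP|K0] := eqVneq K' 0%N; first by move=> /eqP ->; rewrite addn0; right.
have [->|] := eqVneq (\sum_(w in L) o w)%N 0%N; first by left.
rewrite sum_nat_eq0 negb_forall => /existsP[x]; rewrite negb_imply eqb0 negbK.
move=> /andP[xL ox] _; case/negP: K0; rewrite sum_nat_eq0.
apply/forall_inP => z; rewrite memv_cap eqb0 => /andP[zPi /(memv_polarity Qq) zL].
(* A point of O on L^perp is perpendicular to the point <x> of O on [L], hence equal to it. Then x
   is perpendicular to all of [L], and [L] is totally isotropic. *)
apply: contraNN Buv => oz; have Exz := ovoid_unique ox oz (zL x xL).
have [y yL yx] : exists2 y, y \in L & y \notin <[x]>%VS by apply: subv_ex; rewrite dL.
have EL := add_vline_eq dL xL yL (ovoid_neq0 ox) yx.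
have Bxy : B x y = 0.
  have /vlineP[k ->] : x \in <[z]>%VS by rewrite -Exz memv_line.
  by rewrite (polarZl Qq) (polarC Q) zL // mulr0.
by rewrite -EL in uL vL; rewrite (polar_add_vline Qq q_even Bxy uL vL).
Qed.

End Ovoid.

(** * Points and singular subspaces in terms of vectors *)

Section Points.

Variables (F : finFieldType) (n : nat) (Q : 'rV[F]_n -> F).
Hypothesis Qq : quadratic_form Q.
Local Notation V := 'rV[F]_n.
Implicit Types (u v w : V) (U W : {vspace V}).

Lemma mem_points_of v U : (<[v]>%VS \in points_of U) = (v != 0) && (v \in U).
Proof. by rewrite inE dim_vline -memvE; case: (v != 0). Qed.

Lemma mem_quadric v : (<[v]>%VS \in quadric Q) = (v != 0) && (Q v == 0).
Proof. by rewrite inE dim_vline totally_singular_vline //; case: (v != 0). Qed.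

Lemma contained_in_quadricP W :
  reflect (totally_singular Q W) (contained_in_quadric Q W).
Proof.
apply: (iffP subsetP) => [WQ|/totally_singularP QW x].
  apply/totally_singularP => w wW.
  have [->|w0] := eqVneq w 0; first exact: quad0.
  have : <[w]>%VS \in quadric Q by rewrite WQ // mem_points_of w0.
  by rewrite mem_quadric w0 => /eqP.
rewrite inE => /andP[/eqP dx xW]; have [w w0 xE] := vline_repr dx.
by rewrite xE mem_quadric w0 QW ?eqxx // memvE -xE.
Qed.

End Points.

(** * The elliptic solid and its generalized quadrangle *)

Section EllipticSolid.

Variables (F : finFieldType) (n : nat) (Q : 'rV[F]_n -> F).
Hypotheses (q_even : ~~ odd #|F|) (Qq : quadratic_form Q).
Local Notation V := 'rV[F]_n.
Local Notation B := (polar_form Q).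
Implicit Types (u v w x : V) (L W : {vspace V}).

Variable Pi : {vspace V}.
Hypotheses (Pi_solid : \dim Pi = 4%N) (Pi_elliptic : minus_type_on Q Pi).

Local Notation Qm := (points_of Pi :&: quadric Q).

Lemma elliptic_witt_index : witt_index Q Pi = 1%N.
Proof.
by have [_] := Pi_elliptic; rewrite Pi_solid => /(congr1 half); rewrite doubleK => -[].
Qed.

Lemma elliptic_singular_line W :
  (W <= Pi)%VS -> totally_singular Q W -> (\dim W <= 1)%N.
Proof. by move=> WPi; move/(witt_index_max WPi); rewrite elliptic_witt_index. Qed.

(** Otherwise the two vectors would span a totally singular line, against Witt index 1. *)
Lemma elliptic_perp u v : u \in Pi -> v \in Pi -> u != 0 ->
  Q u = 0 -> Q v = 0 -> B u v = 0 -> v \in <[u]>%VS.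
Proof.
move=> uPi vPi u0 Qu Qv Buv; apply: contraT => vu.
have: (\dim (<[u]> + <[v]>) <= 1)%N.
  apply: elliptic_singular_line; first by rewrite subv_add -!memvE uPi.
  apply: totally_singularD; rewrite ?totally_singular_vline ?Qu ?Qv //.
  move=> _ _ /vlineP[k ->] /vlineP[l ->].
  by rewrite (polarZl Qq) (polarZr Qq) Buv !mulr0.
by rewrite dim_add_vline.
Qed.

(** Every field element is a square, so the multiples of a nonsingular vector take every value, in
    particular -Q v. *)
Lemma quad_cancel u v : Q u != 0 -> exists c, Q v + Q (c *: u) = 0.
Proof.
move=> Qu; exists ((- (Q v / Q u)) ^+ #|F|./2).
by rewrite (quadZ Qq) expf_half_sqr // mulNr divfK // subrr.
Qed.

(* A radical vector [r] would be nonsingular; adding a multiple of it makes any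
   vector of [w^perp] singular, where [w] is singular, and this produces a
   totally singular line. *)
Lemma elliptic_radical : (Pi :&: polarity Q Pi = 0)%VS.
Proof.
apply/eqP; rewrite -subv0; apply/subvP => r /memv_capP[rPi rM].
rewrite memv0; apply/negPn/negP => r0.
have {rM} Br u : u \in Pi -> B u r = 0 by apply/(memv_polarity Qq).
have Qr : Q r != 0.
  apply: contra_neq r0 => Qr; apply: Pi_elliptic.1 => // w wPi.
  by rewrite (polarC Q) Br.
have [W [WPi QW]] := witt_index_ex Qq Pi; rewrite elliptic_witt_index => dW.
have [w w0 WE] := vline_repr dW; rewrite {W dW}WE in WPi QW.
have {WPi} wPi : w \in Pi by rewrite memvE.
have {QW} Qw : Q w = 0 by apply/eqP; rewrite -totally_singular_vline.
(* Inside [Pi], w^perp has dimension at least 3, while w and r span at most 2. *)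
have /subvPn[u /memv_capP[uPi]] :
    ~~ (Pi :&: polarity Q <[w]> <= <[w]> + <[r]>)%VS.
  have dS : (\dim (<[w]> + <[r]>) <= 2)%N.
    apply: leq_trans (_ : \dim <[w]> + \dim <[r]> <= _)%N.
      by rewrite -dimv_sum_cap leq_addr.
    by rewrite !dim_vline w0 r0.
  apply/negP => /dimvS/leq_trans/(_ dS) dP.
  have dPi := dim_cap_polarity_line Qq Pi w.
  suff: (\dim Pi <= 2 + 1)%N by rewrite Pi_solid.
  by rewrite -dPi leq_add // leq_b1.
rewrite memv_polarity_line // => /eqP Bwu; apply/negP; rewrite negbK.
have [c Qc] := quad_cancel u Qr.
have /vlineP[k kE] : u + c *: r \in <[w]>%VS.
  apply: elliptic_perp => //; first by rewrite rpredD ?rpredZ.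
    by rewrite (quadD Q) Qc (polarZr Qq) Br // mulr0 addr0.
  by rewrite (polarDr Qq) Bwu (polarZr Qq) Br // mulr0 addr0.
have -> : u = k *: w + (- c) *: r by rewrite -kE scaleNr addrK.
by rewrite memv_add // memvZ // memv_line.
Qed.

(** On a tangent line, a vector not perpendicular to the singular point would produce a second
    singular point. Conversely, [Q] is additive on a totally isotropic line, so [quad_cancel] yields
    a singular point there, and [elliptic_perp] makes it unique. *)
Lemma W_lineP L : reflect [/\ \dim L = 2%N, (L <= Pi)%VS &
  forall u v, u \in L -> v \in L -> B u v = 0] (W_line Pi Qm L).
Proof.
apply: (iffP and3P) => [[/eqP dL LPi /cards1P[y Ey]]|[dL LPi BL]].
  have : y \in Qm :&: points_of L by rewrite Ey set11.
  rewrite 2!in_setI => /andP[/andP[yPi yQ] yL].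
  have [e e0 yE] : exists2 e, e != 0 & y = <[e]>%VS.
    by apply: vline_repr; move: yL; rewrite inE => /andP[/eqP].
  move: yQ yL; rewrite yE mem_points_of mem_quadric // e0 /= => /eqP Qe eL.
  have Be z : z \in L -> B e z = 0.
    move=> zL; apply/eqP; apply: contraT => Bez.
    (* The coefficient c solves Q (z + c e) = Q z + c B(z, e) = 0. *)
    pose f := z + (- (Q z / B e z)) *: e.
    have Bef : B e f != 0.
      by rewrite (polarDr Qq) (polarZr Qq) (polarvv Qq) // mulr0 addr0.
    have f0 : f != 0 by apply: contraNneq Bef => ->; rewrite (polar0r Qq).
    have fL : f \in L by rewrite rpredD ?rpredZ.
    have Qf : Q f = 0.
      rewrite (quadD Q) (quadZ Qq) Qe mulr0 addr0 (polarZr Qq) (polarC Q z).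
      by rewrite mulNr divfK // subrr.
    have : <[f]>%VS \in Qm :&: points_of L.
      by rewrite !in_setI !mem_points_of mem_quadric // f0 fL Qf eqxx (subvP LPi).
    rewrite Ey yE inE => /eqP fe; move: Bef.
    have /vlineP[k ->] : f \in <[e]>%VS by rewrite -fe memv_line.
    by rewrite (polarZr Qq) (polarvv Qq) // mulr0 eqxx.
  have [z zL ze] : exists2 z, z \in L & z \notin <[e]>%VS by apply: subv_ex; rewrite dL.
  split=> // u v; rewrite -(add_vline_eq dL eL zL e0 ze).
  by apply: polar_add_vline => //; apply: Be.
split=> //; first by rewrite dL.
have [e [e0 eL Qe]] : exists e, [/\ e != 0, e \in L & Q e = 0].
  have [u uL u0] : exists2 u, u \in L & u != 0 by apply: subv_neq0_ex; rewrite dL.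
  have [v vL vu] : exists2 v, v \in L & v \notin <[u]>%VS by apply: subv_ex; rewrite dL.
  have [Qu|Qu] := eqVneq (Q u) 0; first by exists u.
  have [c Qc] := quad_cancel v Qu; exists (v + c *: u); split.
  - apply: contraNneq vu => /eqP; rewrite addr_eq0 => /eqP ->.
    by rewrite rpredN memvZ // memv_line.
  - by rewrite rpredD ?rpredZ.
  - by rewrite (quadD Q) Qc (polarZr Qq) BL // mulr0 addr0.
apply/cards1P; exists <[e]>%VS; apply/setP => x; rewrite !in_setI in_set1.
apply/idP/eqP => [/andP[/andP[_ xQ] xL]|->]; last first.
  by rewrite !mem_points_of mem_quadric // e0 eL Qe eqxx (subvP LPi).
have [v v0 xE] : exists2 v, v != 0 & x = <[v]>%VS.
  by apply: vline_repr; move: xL; rewrite inE => /andP[/eqP].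
move: xQ xL; rewrite xE mem_points_of mem_quadric // v0 /= => /eqP Qv vL.
apply: vline_eq => //; apply: elliptic_perp; rewrite ?(subvP LPi) //.
exact: BL.
Qed.

(** The totally isotropic lines through x cover x^perp in [Pi], so any plane that [pick] returns
    contains this plane and equals it by dimension. As the plane itself qualifies, the default 0
    never occurs. *)
Lemma W_planeE x : x \in Pi -> x != 0 ->
  W_plane Pi Qm <[x]> = (Pi :&: polarity Q <[x]>)%VS.
Proof.
move=> xPi x0; rewrite /W_plane; set P0 := (Pi :&: _)%VS.
have dP0 : \dim P0 = 3%N by apply: dim_perp => //; apply: elliptic_radical.
have xP0 : x \in P0 by rewrite memv_cap xPi memv_polarity_line // polarvv ?eqxx.
case: pickP => [P /and3P[/eqP dP PPi /forall_inP PL]|/(_ P0)] /=; last first.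
  rewrite dP0 capvSl /= => /negbT/forall_inPn[L].
  rewrite unfold_in => /andP[/W_lineP[_ LPi BL] xL]; rewrite subv_cap LPi /=.
  case/subvP => v vL; rewrite memv_polarity_line //.
  by apply/eqP/BL => //; rewrite memvE.
have line_sub y : y \in P0 -> y \notin <[x]>%VS -> (<[x]> + <[y]> <= P)%VS.
  case/memv_capP => yPi; rewrite memv_polarity_line // => /eqP Bxy yx.
  apply: PL; rewrite addvSl andbT; apply/W_lineP; split.
  - exact: dim_add_vline.
  - by rewrite subv_add -!memvE xPi.
  - by move=> u w; apply: polar_add_vline.
apply/eqP; rewrite eq_sym eqEdim dP dP0 leqnn andbT; apply/subvP => v vP0.
have [vx|vx] := boolP (v \in <[x]>%VS); last first.
  by apply: (subvP (line_sub v vP0 vx)); rewrite memvE addvSr.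
have [y yP0 yx] : exists2 y, y \in P0 & y \notin <[x]>%VS.
  by apply: subv_ex; rewrite dP0.
by apply: (subvP (line_sub y yP0 yx)); apply: (subvP (addvSl _ _)).
Qed.

(** This is biduality inside [Pi]. If w is not perpendicular to x, then w and x^perp span [Pi];
    subtracting from s the multiple of x that makes the difference perpendicular to w leaves a
    radical vector, which is 0. *)
Lemma polarity_W_plane x s : x \in Pi -> x != 0 -> s \in Pi ->
  (forall v, v \in W_plane Pi Qm <[x]> -> B v s = 0) -> s \in <[x]>%VS.
Proof.
move=> xPi x0 sPi; rewrite W_planeE // => Bs.
have /subvPn[w wPi] : ~~ (Pi <= polarity Q <[x]>)%VS.
  have := dim_perp Qq Pi_solid elliptic_radical xPi x0.
  have := dim_cap_polarity_line Qq Pi x; rewrite Pi_solid => dP dP3.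
  by apply: contra_eqN dP => ->; rewrite dP3.
rewrite memv_polarity_line // => Bxw.
suff : s - (B w s / B x w) *: x \in (Pi :&: polarity Q Pi)%VS.
  by rewrite elliptic_radical memv0 subr_eq0 => /eqP ->; rewrite memvZ // memv_line.
rewrite memv_cap rpredB ?rpredZ //=; apply/(memv_polarity Qq) => u uPi.
have : B (u - (B x u / B x w) *: w) s = 0.
  apply: Bs; rewrite memv_cap rpredB ?rpredZ // memv_polarity_line //=.
  by rewrite (polarDr Qq) -scaleNr (polarZr Qq) mulNr divfK // subrr.
rewrite (polarDl Qq) -!scaleNr (polarZl Qq) (polarDr Qq) (polarZr Qq) => E.
rewrite -[RHS]E (polarC Q u x) !mulNr; congr (_ - _).
by rewrite mulrAC [RHS]mulrAC (mulrC (B w s)).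
Qed.

End EllipticSolid.

(** * Splitting F^6 into the solid and its polar line *)

Section KleinQuadric.

Variables (F : finFieldType) (Q : 'rV[F]_6 -> F).
Hypotheses (q_even : ~~ odd #|F|) (Qq : quadratic_form Q).
Hypothesis Q_plus : plus_type_on Q fullv.
Local Notation V := 'rV[F]_6.
Local Notation B := (polar_form Q).
Local Notation q := #|F|.

Variable Pi : {vspace V}.
Hypotheses (Pi_solid : \dim Pi = 4%N) (Pi_elliptic : minus_type_on Q Pi).

Implicit Types (u v w m s e : V) (L P W : {vspace V}).

Local Notation M := (polarity Q Pi).
Local Notation Qm := (points_of Pi :&: quadric Q).
Local Notation p := (daddv_pi Pi M).
Local Notation r := (daddv_pi M Pi).

Let Pi_nondeg : (Pi :&: M = 0)%VS.
Proof. exact: elliptic_radical. Qed.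

(** The bound [dim_polarity] gives at least 2, and the trivial intersection with [Pi] gives at most
    2. *)
Lemma dim_polarity_solid : \dim M = 2%N.
Proof.
have := dim_polarity Qq Pi; rewrite Pi_solid => dM.
have : (\dim (Pi + M) <= 6)%N.
  by rewrite (leq_trans (dimvS (subvf _))) // dimvf dim_matrix mul1r.
by rewrite dimv_disjoint_sum // Pi_solid; lia.
Qed.

Lemma solid_add_polarity : (Pi + M)%VS = fullv.
Proof.
apply/eqP; rewrite eqEdim subvf dimv_disjoint_sum // Pi_solid dim_polarity_solid.
by rewrite dimvf dim_matrix mul1r.
Qed.

Lemma projD v : v = p v + r v.
Proof.
by apply/esym/daddv_pi_add; rewrite ?solid_add_polarity ?memvf.
Qed.

Lemma proj_mem v : p v \in Pi. Proof. exact: memv_pi. Qed.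

Lemma coproj_mem v : r v \in M. Proof. exact: memv_pi. Qed.

Lemma polar_solid u m : u \in Pi -> m \in M -> B u m = 0.
Proof. by move=> uPi /(memv_polarity Qq) ->. Qed.

Lemma polar_proj u v : u \in Pi -> B u (p v) = B u v.
Proof.
by move=> uPi; rewrite {2}(projD v) (polarDr Qq)
  (polar_solid uPi (coproj_mem v)) addr0.
Qed.

Lemma quad_proj v : Q v = Q (p v) + Q (r v).
Proof.
by rewrite {1}(projD v) (quadD Q) polar_solid ?addr0 ?proj_mem ?coproj_mem.
Qed.

Lemma proj_id v : v \in Pi -> p v = v.
Proof. exact: daddv_pi_id. Qed.

(* A singular vector [m] of [M] would span, with the part of a totally singular
   plane perpendicular to it, a totally singular plane inside [m^perp], which
   also contains [Pi]; so this plane would meet [Pi] in a line. *)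
Lemma polarity_anisotropic m : m \in M -> Q m = 0 -> m = 0.
Proof.
move=> mM Qm; apply/eqP; apply: contraT => m0.
have wV : witt_index Q fullv = 3%N.
  by have [_] := Q_plus; rewrite dimvf dim_matrix mul1r; lia.
have [W [_ QW dW]] := witt_index_ex Qq fullv; rewrite wV in dW.
pose W0 := (W :&: polarity Q <[m]>)%VS; pose T := (W0 + <[m]>)%VS.
have QT : totally_singular Q T.
  apply: totally_singularD => //.
  - by apply: totally_singularS QW; apply: capvSl.
  - by rewrite totally_singular_vline // Qm.
  move=> u w /memv_capP[_]; rewrite memv_polarity_line // => /eqP Bmu /vlineP[k ->].
  by rewrite (polarZr Qq) (polarC Q) Bmu mulr0.
have dT : (3 <= \dim T)%N.
  have := dim_cap_polarity_line Qq W m; rewrite -/W0 dW => dW0.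
  have [mW|mW] := boolP (m \in W).
    suff WT : (W <= T)%VS by have := dimvS WT; rewrite dW.
    apply: subv_trans (addvSl _ _); rewrite subv_cap subvv.
    apply/subvP => w wW; rewrite memv_polarity_line //.
    by rewrite (totally_singular_polar QW).
  have W0T : (\dim W0 < \dim T)%N.
    rewrite (ltn_leqif (dimv_leqif_sup (addvSl W0 <[m]>))).
    apply: contra mW => /subvP/(_ m); rewrite memvE addvSr => /(_ isT).
    by case/memv_capP.
  apply: leq_trans W0T; rewrite -(addn1 (\dim W0)).
  by apply: leq_trans (eq_leq (esym dW0)) _; rewrite leq_add2l leq_b1.
(* Since m is singular and nonzero, nondegeneracy makes m^perp a hyperplane, and it contains both
   [T] and [Pi]. *)
have dTPi : (\dim (T + Pi) <= 5)%N.
  have : (T + Pi <= polarity Q <[m]>)%VS.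
    rewrite subv_add; apply/andP; split; apply/subvP => u uT.
      rewrite memv_polarity_line // (totally_singular_polar QT) //.
      by rewrite memvE addvSr.
    by rewrite memv_polarity_line // (polarC Q) polar_solid.
  have := dim_cap_polarity_line Qq fullv m.
  rewrite capfv [\dim fullv]dimvf dim_matrix mul1r.
  have -> : (fullv <= polarity Q <[m]>)%VS = false.
    apply: contraNF m0 => /subvP Hm; apply/eqP; apply: Q_plus.1; rewrite ?memvf //.
    by move=> w wV'; apply/eqP; rewrite -memv_polarity_line // Hm.
  by rewrite addn1 => -[dm] /dimvS; rewrite dm.
have : (\dim (T :&: Pi) <= 1)%N.
  apply: (elliptic_singular_line Pi_solid Pi_elliptic); first exact: capvSr.
  by apply: totally_singularS QT; apply: capvSl.
have := dimv_sum_cap T Pi; rewrite Pi_solid => E le1.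
have : (3 + 4 <= 5 + 1)%N by apply: leq_trans (leq_add dTPi le1); rewrite E leq_add.
by [].
Qed.

(** If v and p v are singular, so is the component r v in [M], which is therefore 0. *)
Lemma proj_singular v : Q v = 0 -> (Q (p v) == 0) = (v \in Pi).
Proof.
move=> Qv; apply/eqP/idP => [Qpv|/proj_id ->//].
have : Q (r v) = 0 by rewrite -Qv [RHS]quad_proj Qpv add0r.
move/(polarity_anisotropic (coproj_mem v)) => rv.
by rewrite (projD v) rv addr0 proj_mem.
Qed.

Lemma proj_neq0 v : Q v = 0 -> v != 0 -> p v != 0.
Proof.
move=> Qv; apply: contra_neq => pv; have vPi : v \in Pi.
  by rewrite -proj_singular // pv quad0.
by rewrite -(proj_id vPi).
Qed.

(** For u in [Pi], B u v = B u (p v). So v is perpendicular to the plane of x exactly when p v is,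
    and biduality then puts p v on <x>. *)
Lemma mem_conic_of v x : x \in Pi -> x != 0 -> Q v = 0 -> v != 0 ->
  (<[v]>%VS \in conic_of Q Pi Qm <[x]>) = (<[p v]>%VS == <[x]>%VS).
Proof.
move=> xPi x0 Qv v0; rewrite in_setI mem_points_of mem_quadric // v0 Qv eqxx /= andbT.
apply/(memv_polarity Qq _ _)/eqP => [Hv|Epv u].
  apply: vline_eq; first exact: proj_neq0.
  apply: (polarity_W_plane q_even Qq Pi_solid Pi_elliptic) => //; first exact: proj_mem.
  move=> u uW; rewrite polar_proj ?Hv //.
  by move: uW; rewrite W_planeE // => /memv_capP[].
rewrite W_planeE // => /memv_capP[uPi]; rewrite memv_polarity_line // => /eqP Bxu.
have /vlineP[k kE] : p v \in <[x]>%VS by rewrite -Epv memv_line.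
by rewrite -polar_proj // kE (polarZr Qq) (polarC Q) Bxu mulr0.
Qed.

(** * Membership in H_O *)

Variable O : {set {vspace V}}.
Hypothesis O_ovoid : is_W_ovoid Pi Qm O.

Local Notation o v := (<[v]>%VS \in O).
Local Notation H := (hyperoval_of_ovoid Q Pi Qm O).

Let O_points : O \subset points_of Pi. Proof. exact: O_ovoid.1. Qed.

Let O_line L : \dim L = 2%N -> (L <= Pi)%VS ->
  (forall u v, u \in L -> v \in L -> B u v = 0) -> #|O :&: points_of L| = 1%N.
Proof. by move=> dL LPi BL; apply: O_ovoid.2; apply/W_lineP. Qed.

(** The elliptic quadric is itself an ovoid of W(q), as the lines of W(q) are its tangents. *)
Lemma elliptic_quadric_card : #|Qm| = (q ^ 2 + 1)%N.
Proof.
apply: (card_ovoid q_even Qq Pi_solid Pi_nondeg); first exact: subsetIl.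
move=> L dL LPi BL.
by have /and3P[_ _ /eqP] : W_line Pi Qm L by apply/W_lineP.
Qed.

Lemma W_ovoid_card : #|O| = (q ^ 2 + 1)%N.
Proof. exact: (card_ovoid q_even Qq Pi_solid Pi_nondeg). Qed.

Lemma hyperoval_sub : H \subset quadric Q.
Proof.
rewrite subUset; apply/andP; split.
  by apply/bigcupsP => x _; apply: subsetIr.
exact: subset_trans (subsetDl _ _) (subsetIr _ _).
Qed.

Lemma hyperoval_repr x : x \in H -> exists2 v, v != 0 & x = <[v]>%VS.
Proof.
move/(subsetP hyperoval_sub); rewrite inE => /andP[/eqP dx _].
exact: vline_repr.
Qed.

(** Outside [Pi], p v is nonsingular, and only the conic of <p v> can contain <v>. In [Pi], p v = v
    and no conic contains <v>, since it would belong to the singular point <v>. *)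
Lemma mem_hyperoval v : v != 0 ->
  (<[v]>%VS \in H) = (Q v == 0) && ((v \in Pi) != o (p v)).
Proof.
move=> v0; have [Qv|Qv] := eqVneq (Q v) 0; last first.
  apply: contraNF Qv => /(subsetP hyperoval_sub).
  by rewrite mem_quadric // => /andP[].
rewrite !inE -memvE dim_vline v0 totally_singular_vline // Qv eqxx /= andbT.
have -> : (<[v]>%VS \in \bigcup_(x in O :\: Qm) conic_of Q Pi Qm x) =
    (v \notin Pi) && o (p v).
  rewrite -(proj_singular Qv); apply/bigcupP/andP => [[x]|[Qpv opv]].
    rewrite in_setD => /andP[xQ xO].
    have [w w0 xE] := vline_repr (ovoid_dim O_points xO).
    rewrite xE in xQ xO *; have wPi := ovoid_mem O_points xO.
    rewrite mem_conic_of // => /eqP pvw; rewrite pvw; split=> //.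
    apply: contra xQ => Qpv.
    by rewrite -pvw in_setI mem_points_of mem_quadric // proj_neq0 // proj_mem.
  exists <[p v]>%VS; last by rewrite mem_conic_of ?proj_mem ?proj_neq0 ?eqxx.
  by rewrite !inE opv totally_singular_vline // (negPf Qpv) !andbF.
case: (boolP (v \in Pi)) => [vPi|_] /=; last first.
  by rewrite andbF orbF; case: (_ \in O).
by rewrite proj_id // andbT; case: (_ \in O).
Qed.

(** * Lines of the quadric *)

Lemma proj_inj_on L : (L :&: M = 0)%VS -> {in L &, injective p}.
Proof.
move=> LM u v uL vL puv; apply/eqP; rewrite -subr_eq0 -memv0 -LM memv_cap.
rewrite rpredB //= (projD (u - v)) linearB /= puv subrr add0r.
exact: coproj_mem.
Qed.

Lemma singular_cap_polarity L : totally_singular Q L -> (L :&: M = 0)%VS.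
Proof.
move=> /totally_singularP QL; apply/eqP; rewrite -subv0; apply/subvP => v.
by move=> /memv_capP[/QL Qv vM]; rewrite (polarity_anisotropic vM Qv) mem0v.
Qed.

Lemma sum_proj L : totally_singular Q L ->
  (\sum_(v in L) o (p v) = \sum_(s in (p @: L)%VS) o s)%N.
Proof.
move=> QL; have pinj := proj_inj_on (singular_cap_polarity QL).
rewrite -(big_imset (fun s => nat_of_bool (o s)) pinj) /=.
apply: eq_bigl => s; apply/imsetP/memv_imgP => [[u uL ->]|[u uL ->]].
  by exists u.
by exists u.
Qed.

(** The identity [a xor b] + 2ab = a + b is summed over the nonzero v in [L], where a says that v is
    in [Pi] and b that <p v> is in O. As p v = v on [Pi], the products ab give the sum over the
    intersection with [Pi]; as p is injective on [L], the b give the sum over p(L). *)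
Lemma sum_hyperoval_line L : totally_singular Q L ->
  ((q - 1) * #|H :&: points_of L| + 2 * \sum_(v in (L :&: Pi)%VS) o v
   = (q ^ \dim (L :&: Pi) - 1) + \sum_(v in (p @: L)%VS) o v)%N.
Proof.
move=> QL; rewrite -sum_proj // -sum_point_vectors; last first.
  by move=> x /hyperoval_repr[v v0 ->]; rewrite dim_vline v0.
have -> : (\sum_(v in (L :&: Pi)%VS) o v = \sum_(v in L) (v \in Pi) * o v)%N.
  rewrite [RHS](bigID (mem Pi)) /= [X in (_ + X)%N]big1 => [|v]; last first.
    by move=> /andP[_ /negPf ->].
  rewrite addn0; apply: eq_big => [v|v]; first by rewrite memv_cap.
  by rewrite memv_cap => /andP[_ ->]; rewrite mul1n.
have -> : (q ^ \dim (L :&: Pi) - 1 = \sum_(v in L) ((v \in Pi) && (v != 0%R)))%N.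
  rewrite -card_vspace_neq0 -sum1_card [RHS](bigID (fun v => (v \in Pi) && (v != 0))) /=.
  rewrite [X in (_ + X)%N]big1 => [|v /andP[_ /negPf ->] //].
  rewrite addn0; apply: eq_big => [v|v]; rewrite !inE memv_cap; last first.
    by move=> /andP[/andP[_ ->] ->].
  by rewrite -andbA.
rewrite big_distrr -!big_split /=; apply: eq_bigr => v vL.
have Qv : Q v = 0 by move/totally_singularP: QL; apply.
have [->|v0] := eqVneq v 0.
  rewrite mem0v linear0.
  have -> : (<[0 : V]>%VS \in H) = false.
    by apply/negP => /(subsetP hyperoval_sub); rewrite mem_quadric // eqxx.
  by case: (boolP (o 0)) => // /(ovoid_neq0 O_points); rewrite eqxx.
rewrite mem_hyperoval // Qv eqxx /=.
by have [vPi|vPi] := boolP (v \in Pi); rewrite ?(proj_id vPi); case: (<[_]>%VS \in O).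
Qed.

Lemma hyperoval_line L : \dim L = 2%N -> contained_in_quadric Q L ->
  #|H :&: points_of L| = 0%N \/ #|H :&: points_of L| = 2%N.
Proof.
move=> dL /(contained_in_quadricP Qq) QL.
have q1 : (0 < q - 1)%N by rewrite subn_gt0 finRing_gt1.
have dpL : \dim (p @: L) = 2%N.
  rewrite limg_dim_eq //; apply/eqP; rewrite -subv0; apply/subvP => v.
  rewrite memv_cap memv_ker => /andP[vL /eqP pv].
  rewrite -(singular_cap_polarity QL) memv_cap vL (projD v) pv add0r.
  exact: coproj_mem.
have pLPi : (p @: L <= Pi)%VS.
  by apply/subvP => _ /memv_imgP[v _ ->]; apply: proj_mem.
have := sum_hyperoval_line QL.
have [LPi|[e /memv_capP[eL ePi] e0]] :
    (L :&: Pi = 0)%VS \/ exists2 e, e \in (L :&: Pi)%VS & e != 0.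
  have [->|LPi] := eqVneq (L :&: Pi)%VS 0%VS; first by left.
  by right; apply: subv_neq0_ex; rewrite lt0n dimv_eq0.
- rewrite LPi dimv0 expn0 subnn add0n big1 => [|v]; last first.
    rewrite memv0 => /eqP ->.
    by case: (boolP (o 0)) => // /(ovoid_neq0 O_points); rewrite eqxx.
  rewrite muln0 addn0 => E.
  have [||] := sum_hyperbolic q_even Qq Pi_solid Pi_nondeg O_points O_line dpL pLPi.
  (* If p(L) were totally isotropic, it would contain a singular point <p v> with v in [L], and
     [proj_singular] would put v in [Pi]. *)
  + have [|] := boolP [exists u in (p @: L)%VS, exists v in (p @: L)%VS, B u v != 0].
      by move=> /exists_inP[u uL /exists_inP[v vL Buv]]; exists u, v.
    rewrite negb_exists_in => /forall_inP BL.
    have /(W_lineP q_even Qq Pi_solid Pi_elliptic)/and3P[_ _ /cards1P[y Ey]] :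
        [/\ \dim (p @: L) = 2%N, (p @: L <= Pi)%VS &
        forall u v, u \in (p @: L)%VS -> v \in (p @: L)%VS -> B u v = 0].
      split=> // u v /BL; rewrite negb_exists_in => /forall_inP/[apply].
      by rewrite negbK => /eqP.
    have : y \in Qm :&: points_of (p @: L) by rewrite Ey set11.
    have [s s0 ->] : exists2 s, s != 0 & y = <[s]>%VS.
      have : y \in Qm :&: points_of (p @: L) by rewrite Ey set11.
      by rewrite !inE => /andP[_ /andP[/eqP dy _]]; apply: vline_repr.
    rewrite !in_setI !mem_points_of mem_quadric // s0 /= => /andP[/andP[_ Qs]].
    case/memv_imgP => v vL sE; move: Qs; rewrite sE proj_singular; last first.
      by move/totally_singularP: QL; apply.
    move=> vPi; have : v \in (L :&: Pi)%VS by rewrite memv_cap vL.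
    by rewrite LPi memv0 => /eqP v0; move: s0; rewrite sE v0 linear0 eqxx.
  + by move=> E0; left; move/eqP: E; rewrite E0 muln_eq0 (gtn_eqF q1) /= => /eqP.
  + by move=> E2; right; move/eqP: E; rewrite E2 mulnC eqn_pmul2r // => /eqP.
have Qe : Q e = 0 by move/totally_singularP: QL; apply.
have LPiE : (L :&: Pi)%VS = <[e]>%VS.
  apply/esym/eqP; rewrite eqEdim dim_vline e0 -memvE memv_cap eL ePi.
  apply: (elliptic_singular_line Pi_solid Pi_elliptic); first exact: capvSr.
  by apply: totally_singularS QL; apply: capvSl.
have [s spL se] : exists2 s, s \in (p @: L)%VS & s \notin <[e]>%VS.
  by apply: subv_ex; rewrite dpL.
have epL : e \in (p @: L)%VS by rewrite -(proj_id ePi) memv_img.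
(* The line p(L) is totally isotropic and has one point in O. After division by q - 1 the identity
   becomes k + 2 [e in O] = 2, where k counts the points of [L] in H_O. *)
rewrite LPiE dim_vline e0 expn1 (sum_line O_points e0).
rewrite -[(p @: L)%VS](add_vline_eq dpL epL spL e0 se).
rewrite (sum_isotropic q_even Qq O_points O_line) //; first last.
- have /memv_imgP[v vL ->] := spL.
  by rewrite polar_proj // (totally_singular_polar QL).
- exact: (subvP pLPi).
rewrite mulnCA -mulnDr addnn -mul2n mulnC => /eqP; rewrite eqn_pmul2r // => /eqP.
by move: #|H :&: _| => k; case: (o e); clear; lia.
Qed.

(** * The size of H_O, and the planes disjoint from it *)

Let Qm_points x : x \in Qm -> \dim x = 1%N.
Proof. by rewrite !inE => /andP[/andP[/eqP]]. Qed.

(** As squaring is bijective, every nonsingular point contains exactly one vector of value c. *)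
Lemma card_level (c : F) : c != 0 -> #|[set s : V | o s && (Q s == c)]| = #|O :\: Qm|.
Proof.
move=> c0; rewrite -(card_in_imset (f := fun s : V => <[s]>%VS)); last first.
  move=> s t; rewrite !inE => /andP[_ /eqP Qs] /andP[_ /eqP Qt] st.
  have /vlineP[k sE] : s \in <[t]>%VS by rewrite -st memv_line.
  suff k1 : k = 1 by rewrite sE k1 scale1r.
  apply: (sqrf_inj q_even); apply: (mulIf c0).
  by rewrite /= expr1n mul1r -{1}Qt -(quadZ Qq) -sE.
apply: eq_card => x; apply/imsetP/setDP => [[s]|[xO xQ]].
  rewrite inE => /andP[os /eqP Qs] ->; split=> //.
  by rewrite in_setI negb_and mem_quadric // Qs (negPf c0) andbF orbT.
have [w w0 xE] := vline_repr (ovoid_dim O_points xO).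
have Qw : Q w != 0.
  apply: contra xQ => Qw.
  have wPi : w \in Pi by apply: (ovoid_mem O_points); rewrite -xE.
  by rewrite xE in_setI mem_points_of mem_quadric // w0 Qw wPi.
pose k := (c / Q w) ^+ q./2.
have Qk : Q (k *: w) = c by rewrite (quadZ Qq) expf_half_sqr // divfK.
have kw0 : k *: w != 0 by apply: contraNneq c0 => kw; rewrite -Qk kw quad0.
have xE' : x = <[k *: w]>%VS.
  by rewrite xE; apply/esym/vline_eq => //; rewrite memvZ // memv_line.
by exists (k *: w) => //; rewrite inE -xE' xO Qk eqxx.
Qed.

(** The vectors are sorted by their component m in [M], one of q^2 - 1 nonzero vectors. The
    component s in [Pi] must then satisfy Q s = Q m, since -Q m = Q m, and by [card_level] the
    number of such s does not depend on m. *)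
Lemma card_conic_vectors :
  #|[set v : V | [&& v \notin Pi, Q v == 0 & o (p v)]]| =
  ((q ^ 2 - 1) * #|O :\: Qm|)%N.
Proof.
rewrite -sum1_card (partition_big r (fun m => (m \in M) && (m != 0))) /=; last first.
  move=> v; rewrite inE => /and3P[vPi _ _]; rewrite coproj_mem /=.
  by apply: contraNneq vPi => rv; rewrite (projD v) rv addr0 proj_mem.
rewrite (eq_bigr (fun=> #|O :\: Qm|)) => [|m /andP[mM m0]].
  by have := card_vspace_neq0 M; rewrite dim_polarity_solid sum_nat_const => <-.
have Qm0 : Q m != 0 by apply: contra_neq m0; apply: polarity_anisotropic.
rewrite -(card_level Qm0) sum1_card -[RHS](card_imset _ (addIr m)).
apply: eq_card => v; rewrite [LHS]unfold_in inE.
have opp2 (a : F) : - a = a by apply: (oppr_even q_even (V := F^o)).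
apply/andP/imsetP => [[/and3P[_ Qv ov] /eqP rv]|[s]].
  exists (p v); last by rewrite -rv -projD.
  rewrite inE ov -rv -(opp2 (Q (r v))) -addr_eq0 -quad_proj //.
rewrite inE => /andP[os /eqP Qs] ->.
have sPi := ovoid_mem O_points os.
have ps : p (s + m) = s.
  have : p (s + m) - s \in (Pi :&: M)%VS.
    rewrite memv_cap rpredB ?proj_mem //=.
    have -> : p (s + m) - s = m - r (s + m).
      apply/eqP; rewrite subr_eq addrAC eq_sym subr_eq addrC; apply/eqP.
      by rewrite -projD.
    by rewrite rpredB ?coproj_mem.
  by rewrite Pi_nondeg memv0 subr_eq0 => /eqP.
have rm : r (s + m) = m.
  by apply: (addrI (p (s + m))); rewrite -projD ps.
split; last by rewrite rm.
rewrite ps os quad_proj ps rm Qs -{1}(opp2 (Q m)) addNr eqxx /= andbT.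
apply/negP => smPi; have := proj_id smPi; rewrite ps => /eqP.
by rewrite -[X in X == _]addr0 (inj_eq (addrI s)) eq_sym (negPf m0).
Qed.

Lemma card_hyperoval : #|H| = ((q ^ 2 + 1 - #|O :&: Qm|) * (q + 2))%N.
Proof.
have q1 : (0 < q - 1)%N by rewrite subn_gt0 finRing_gt1.
have dO : #|O :\: Qm| = (q ^ 2 + 1 - #|O :&: Qm|)%N.
  by rewrite cardsD W_ovoid_card.
have dQ : #|Qm :\: O| = (q ^ 2 + 1 - #|O :&: Qm|)%N.
  by rewrite cardsD elliptic_quadric_card setIC.
apply/eqP; rewrite -(eqn_pmul2l q1); apply/eqP.
have -> : ((q - 1) * #|H| = \sum_(v in (fullv : {vspace V})) (<[v]>%VS \in H))%N.
  rewrite sum_point_vectors => [|x /hyperoval_repr[v v0 ->]]; last first.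
    by rewrite dim_vline v0.
  congr (_ * #|pred_of_set _|)%N; apply/esym/setIidPl/subsetP => x.
  by move=> /hyperoval_repr[v v0 ->]; rewrite mem_points_of v0 memvf.
(* Both differences of O and the elliptic quadric have the same size k. Vectors in [Pi] contribute
   (q - 1) k and the others (q^2 - 1) k, in total (q - 1)(q + 2) k. *)
transitivity (\sum_(v in Pi) (<[v]>%VS \in Qm :\: O) +
   #|[set v : V | [&& v \notin Pi, Q v == 0%R & o (p v)]]|)%N; last first.
  rewrite card_conic_vectors sum_point_vectors; last first.
    by move=> x /setDP[/Qm_points].
  rewrite (setIidPl _); last by rewrite (subset_trans (subsetDl _ _)) ?subsetIl.
  rewrite dO dQ; move: (q ^ 2 + 1 - _)%N => k; have := finRing_gt1 F.
  by case: q => // s _; rewrite expn2_sub1 subn1 /=; ring.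
rewrite (bigID (mem Pi)) /=; congr addn.
  apply: eq_big => [v|v]; first by rewrite memvf.
  move=> /andP[_ vPi]; have [->|v0] := eqVneq v 0.
    have -> : (<[0 : V]>%VS \in H) = false.
      by apply/negP => /(subsetP hyperoval_sub); rewrite mem_quadric // eqxx.
    by rewrite !inE dim_vline eqxx andbF.
  rewrite mem_hyperoval // in_setD in_setI mem_points_of mem_quadric // v0 vPi.
  by rewrite proj_id //; case: (Q v == 0); case: (<[v]>%VS \in O).
rewrite -sum1_card [RHS]big_mkcond [LHS]big_mkcond; apply: eq_bigr => v _.
rewrite memvf inE /=; case: (boolP (v \in Pi)) => vPi //=.
have v0 : v != 0 by apply: contraNneq vPi => ->; rewrite mem0v.
rewrite mem_hyperoval // (negPf vPi).
by case: (Q v == 0) => //=; case: (<[_]>%VS \in O).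
Qed.

(** O and the elliptic quadric have equal size, so the part of [H] in [Pi] is empty only if they
    coincide. *)
Lemma hyperoval_neq0 : O != Qm -> H != set0.
Proof.
apply: contra_neq => H0; apply/esym/eqP.
rewrite eqEcard W_ovoid_card elliptic_quadric_card leqnn andbT -setD_eq0.
by rewrite -subset0 -H0 subsetUr.
Qed.

(** By dimension, [P] meets [Pi] in a singular point, which avoids [H] only if it is in O.
    Conversely, let <e> be a singular point of O in [P]; all of [P] is perpendicular to e. A point
    of [P] in [Pi] is then <e> itself, not in [H]; one of [H] outside [Pi] would project to a point
    of O perpendicular to e, hence to <e>, against [proj_singular]. *)
Lemma plane_disjoint_hyperoval P :
  \dim P = 3%N -> contained_in_quadric Q P ->
  [disjoint points_of P & H] <-> exists2 x, x \in O :&: Qm & (x <= P)%VS.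
Proof.
move=> dP /(contained_in_quadricP Qq) QP.
have QPw w : w \in P -> Q w = 0 by move/totally_singularP: QP; apply.
split=> [PH|[x]].
  have [e /memv_capP[eP ePi] e0] : exists2 e, e \in (P :&: Pi)%VS & e != 0.
    apply: subv_neq0_ex; have := dimv_sum_cap P Pi; rewrite dP Pi_solid.
    have : (\dim (P + Pi) <= 6)%N.
      by rewrite (leq_trans (dimvS (subvf _))) // dimvf dim_matrix mul1r.
    by case: (\dim (P :&: Pi)) => // + E; rewrite -(addn0 (\dim _)) E.
  exists <[e]>%VS; last by rewrite -memvE.
  have : <[e]>%VS \notin H.
    by have /disjointFr -> := PH; rewrite // mem_points_of e0.
  rewrite mem_hyperoval // QPw // eqxx proj_id // ePi /= negbK => /eqP oe.
  by rewrite in_setI -oe in_setI mem_points_of mem_quadric // e0 ePi QPw ?eqxx.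
rewrite in_setI => /andP[xO xQ] xP.
have [e e0 xE] := vline_repr (ovoid_dim O_points xO).
move: xO xQ xP; rewrite xE in_setI mem_points_of mem_quadric // e0 /=.
move=> oe /andP[ePi /eqP Qe]; rewrite -memvE => eP.
rewrite disjoint_sym disjoint_subset; apply/subsetP => y yH; rewrite inE.
apply/negP; have [v v0 yE] := hyperoval_repr yH.
move: yH; rewrite yE mem_points_of v0 mem_hyperoval //= => /andP[_ vH] vP.
have [vPi|vPi] := boolP (v \in Pi); move: vH.
  rewrite vPi proj_id // (vline_eq v0 (_ : v \in <[e]>%VS)) ?oe //.
  apply: (elliptic_perp Qq Pi_solid Pi_elliptic); rewrite ?QPw //.
  exact: totally_singular_polar QP eP vP.
rewrite (negPf vPi); case: (boolP (o (p v))) => // opv _.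
case/negP: vPi; rewrite -(proj_singular (QPw v vP)).
have Eepv : <[e]>%VS = <[p v]>%VS.
  apply: (ovoid_unique q_even Qq O_points O_line) => //.
  by rewrite polar_proj // (totally_singular_polar QP).
have /vlineP[k ->] : p v \in <[e]>%VS by rewrite Eepv memv_line.
by rewrite (quadZ Qq) Qe mulr0 eqxx.
Qed.

End KleinQuadric.

Theorem theorem4p2 (F : finFieldType) (q_even : ~~ odd #|F|)
    (Q : 'rV[F]_6 -> F) (Q_quadratic : quadratic_form Q)
    (Q_plus : plus_type_on Q fullv)
    (Pi : {vspace 'rV[F]_6}) (Pi_solid : \dim Pi = 4%N)
    (Pi_elliptic : minus_type_on Q Pi)
    (O : {set {vspace 'rV[F]_6}}) :
  let q := #|F| in
  let Qminus := points_of Pi :&: quadric Q in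
  let H := hyperoval_of_ovoid Q Pi Qminus O in
  is_W_ovoid Pi Qminus O -> O != Qminus ->
  [/\ is_hyperoval Q H,
      #|H| = ((q ^ 2 + 1 - #|O :&: Qminus|) * (q + 2))%N &
      forall P : {vspace 'rV[F]_6},
        \dim P = 3%N -> contained_in_quadric Q P ->
        ([disjoint points_of P & H] <->
         exists2 x, x \in O :&: Qminus & (x <= P)%VS)].
Proof.
move=> q Qminus H O_ovoid O_neq; split; first split.
- exact: hyperoval_neq0.
- exact: hyperoval_sub.
- by move=> L dL LQ; apply: hyperoval_line.
- exact: card_hyperoval.
- by move=> P dP PQ; apply: plane_disjoint_hyperoval.
Qed.
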